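(* Let $G_C$ be the graph of the map of Canada, i.e. the simple graph with vertex set $\{\mathrm{YT},\mathrm{BC},\mathrm{NT},\mathrm{AB},\mathrm{SK},\mathrm{NU},\mathrm{MB},\mathrm{ON},\mathrm{QC},\mathrm{NB},\mathrm{NL},\mathrm{NS}\}$ and the 15 edges YT–BC, YT–NT, BC–NT, BC–AB, AB–NT, AB–SK, SK–NT, SK–MB, MB–NU, NU–NT, MB–ON, ON–QC, QC–NB, QC–NL, NB–NS. Then the number of proper colorings of $G_C$ with $3$ colors is $\chi(G_C,3)=576$.
   Context: For a finite simple graph $G$ and a positive integer $t$, $\chi(G,t)$ denotes the number of maps $f:V(G)\to C$, where $C$ is a fixed set of $t$ colors, with $f(u)\neq f(v)$ whenever $\{u,v\}$ is an edge of $G$ (proper colorings, not counted up to any symmetry). The vertices of $G_C$ stand for provinces and territories of Canada (standard postal abbreviations), two being adjacent if they share a border of positive length on the map. *)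

(* Defs.v *)
From HB Require Import structures.
From mathcomp Require Import all_boot.

Set Implicit Arguments.
Unset Strict Implicit.
Unset Printing Implicit Defensive.

Record sgraph := SGraph {
  vertex :> finType;
  adj : rel vertex;
  adj_sym : symmetric adj;
  adj_irr : irreflexive adj
}.

Definition proper_coloring (G : sgraph) (t : nat) (f : {ffun G -> 'I_t}) : bool :=
  [forall u : G, forall v : G, adj u v ==> (f u != f v)].

(* Colorings are labelled: no quotient by color permutations or graph symmetries. *)
Definition chi (G : sgraph) (t : nat) : nat :=
  #|[set f : {ffun G -> 'I_t} | proper_coloring f]|.

Inductive province : predArgType :=
  YT | BC | NT | AB | SK | NU | MB | ON | QC | NB | NL | NS.

Definition provinces : seq province :=
  [:: YT; BC; NT; AB; SK; NU; MB; ON; QC; NB; NL; NS].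

Definition province_index (p : province) : nat :=
  match p with
  | YT => 0 | BC => 1 | NT => 2 | AB => 3 | SK => 4 | NU => 5
  | MB => 6 | ON => 7 | QC => 8 | NB => 9 | NL => 10 | NS => 11
  end.

Lemma province_indexK : cancel province_index (nth YT provinces).
Proof. by case. Qed.

HB.instance Definition _ := Countable.copy province (can_type province_indexK).

Lemma provinces_enumP : Finite.axiom provinces.
Proof. by case. Qed.

HB.instance Definition _ := isFinite.Build province provinces_enumP.

(* Each edge is listed once, in one orientation. *)
Definition canada_edges : seq (province * province) :=
  [:: (YT, BC); (YT, NT); (BC, NT); (BC, AB); (AB, NT);
      (AB, SK); (SK, NT); (SK, MB); (MB, NU); (NU, NT);
      (MB, ON); (ON, QC); (QC, NB); (QC, NL); (NB, NS)].

Definition canada_adj : rel province :=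
  fun u v => ((u, v) \in canada_edges) || ((v, u) \in canada_edges).

Lemma canada_adj_sym : symmetric canada_adj.
Proof. by move=> u v; rewrite /canada_adj orbC. Qed.

Lemma canada_adj_irr : irreflexive canada_adj.
Proof. by case. Qed.

Definition canada_graph : sgraph := SGraph canada_adj_sym canada_adj_irr.

(* Main.v *)
Require Import Defs.
From mathcomp Require Import all_boot.

(** The vertices are colored one after the other. Fixing the color of the next
    vertex splits the set of colorings that extend a given partial coloring, and
    a color that clashes with a neighbor contributes nothing. For the map of
    Canada this search tree is small enough to be evaluated. *)

Section Extensions.

Variables (G : sgraph) (t : nat).

Implicit Types (ds vs : seq G) (g : G -> nat).

(* [g] is a partial coloring: only its values on the list [ds] matter. *)
Definition extensions ds g : {set {ffun G -> 'I_t}} :=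
  [set f | proper_coloring f & all (fun u => f u == g u :> nat) ds].

(** Colors are plain naturals and [g] is a total function updated pointwise, so that closed
    instances evaluate. Filtering before the recursive call prunes the search. *)
Fixpoint count_extensions ds vs g : nat :=
  if vs is v :: vs' then
    sumn [seq count_extensions (v :: ds) vs' [eta g with v |-> c]
         | c <- iota 0 t & all (fun u => adj v u ==> (c != g u)) ds]
  else 1.

Lemma all_agree_update ds g v c (f : {ffun G -> 'I_t}) : v \notin ds ->
  all (fun u => f u == [eta g with v |-> c] u :> nat) ds =
  all (fun u => f u == g u :> nat) ds.
Proof.
move=> vds; apply: eq_in_all => u uds /=.
by case: (u =P v) => // uv; rewrite -uv uds in vds.
Qed.

Lemma card_extensions_split ds g v : v \notin ds ->
  #|extensions ds g| =
  \sum_(c < t) #|extensions (v :: ds) [eta g with v |-> val c]|.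
Proof.
move=> vds; rewrite -sum1_card (partition_big (fun f : {ffun G -> 'I_t} => f v) predT) //=.
apply: eq_bigr => c _; rewrite -sum1_card; apply: eq_bigl => f.
rewrite !inE /= eqxx all_agree_update // -val_eqE /=.
by rewrite andbCA andbC.
Qed.

Lemma card_extensions_clash ds g v c : v \notin ds ->
  ~~ all (fun u => adj v u ==> (c != g u)) ds ->
  #|extensions (v :: ds) [eta g with v |-> c]| = 0.
Proof.
move=> vds /allPn[u uds]; rewrite negb_imply negbK => /andP[vu /eqP cgu].
apply/eqP; rewrite cards_eq0; apply/eqP/setP => f; rewrite !inE /= eqxx.
rewrite all_agree_update //; apply/negP => /andP[/forallP/(_ v)/forallP/(_ u)].
rewrite vu /= => fvu /andP[/eqP fv /allP/(_ u uds)/eqP fu].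
by rewrite -val_eqE /= fv fu cgu eqxx in fvu.
Qed.

(** The only candidate is [g] itself, whose values the bound [gt] turns into elements of ['I_t]. *)
Lemma card_extensions_total ds g :
  (forall u, u \in ds) -> (forall u, g u < t) ->
  (forall u w, adj u w -> g u != g w) -> #|extensions ds g| = 1.
Proof.
move=> dsT gt gP; apply/eqP/cards1P; exists [ffun u => Ordinal (gt u)].
apply/setP => f; rewrite !inE; apply/andP/eqP => [[_ /allP fg]|->].
  by apply/ffunP => u; apply: val_inj; rewrite ffunE; apply/eqP/fg.
split; last by apply/allP => u _; rewrite ffunE.
apply/forallP => u; apply/forallP => w; apply/implyP => uw.
by rewrite !ffunE -val_eqE gP.
Qed.

(** The conditions on [g] over [ds] are the invariant of the induction on [vs]: they justify the
    value 1 at a leaf, where [ds] contains every vertex. *)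
Lemma card_extensions vs ds g :
  uniq (vs ++ ds) -> (forall u, u \in vs ++ ds) ->
  {in ds, forall u, g u < t} ->
  {in ds &, forall u w, adj u w -> g u != g w} ->
  #|extensions ds g| = count_extensions ds vs g.
Proof.
elim: vs ds g => [|v vs IHvs] ds g /=.
  by move=> _ dsT gt gP; apply: card_extensions_total; auto.
rewrite mem_cat negb_or -andbA => /and3P[vvs vds vsds] dsT gt gP.
rewrite (card_extensions_split _ _ _ vds) sumnE big_map big_filter.
rewrite -(big_mkord predT (fun c =>
  #|extensions (v :: ds) [eta g with v |-> c]|)) /index_iota subn0.
(* Both sums now range over all colors below [t]; the filter becomes a conditional with value 0 at
   clashing colors. *)
rewrite [RHS]big_mkcond; apply: eq_big_seq => c /=.
rewrite mem_iota add0n => /= ct.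
case: ifPn => [/allP cP|]; last exact: card_extensions_clash.
have upd u : u \in ds -> (u == v) = false.
  by move=> uds; apply: contraNF vds => /eqP <-.
apply: IHvs.
- by rewrite uniq_catC /= mem_cat negb_or vds vvs uniq_catC.
- by move=> u; have := dsT u; rewrite !(inE, mem_cat) orbCA.
- move=> u; rewrite inE => /predU1P[->|uds] /=; first by rewrite eqxx.
  by rewrite upd // gt.
(* Loops at [v] are excluded, edges between [v] and [ds] are covered by [cP] in either orientation,
   edges within [ds] by [gP]. *)
move=> u w; rewrite !inE => /predU1P[->|uds] /predU1P[->|wds] /=.
- by rewrite adj_irr.
- by rewrite eqxx upd // => vw; move/implyP: (cP w wds); apply.
- rewrite eqxx upd // adj_sym eq_sym => vu.
  by move/implyP: (cP u uds); apply.
by rewrite !upd //; apply: gP.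
Qed.

Lemma chi_count_extensions vs : uniq vs -> (forall u, u \in vs) ->
  chi G t = count_extensions [::] vs (fun=> 0).
Proof.
(* With no vertex colored yet the invariant is vacuous, and the default color 0 is never read. *)
move=> vsU vsT; rewrite -card_extensions ?cats0 //.
by apply: eq_card => f; rewrite !inE andbT.
Qed.

End Extensions.

Theorem mainTheorem2 : chi canada_graph 3 = 576.
Proof.
(* In the order of [provinces] each vertex after [YT] has an earlier neighbor, so at most two colors
   survive at each later level of the search. *)
by rewrite (@chi_count_extensions canada_graph 3 provinces) //; case.
Qed.
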